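(* Let $L,T,K>0$, $1<\beta\le 2$, let $M\ge 2$, $N\ge1$, $J\ge1$ be integers, and let $h=L/M$, $\tau=T/N$, $x_i=ih$, $t_n=n\tau$, $t_{n-1+\sigma}=(n-1+\sigma)\tau$, where $\sigma\in[\frac12,1]$ and $m$, $\alpha_r$, $\lambda_r$, $\hat c_k^{(n)}$, $g_k^{(\beta)}$, $c_*^{(\beta)}$ are as defined in the context. Given functions $f$ and $\phi$, put $f_i^{n-1+\sigma}=f(x_i,t_{n-1+\sigma})$, and let $\{u_i^n : 0\le i\le M,\ 0\le n\le N\}$ be the solution of the difference scheme $$\sum_{k=0}^{n-1}\hat c_k^{(n)}\left(u_i^{n-k}-u_i^{n-k-1}\right)=-Kh^{-\beta}\sum_{k=i-M}^{i}g_k^{(\beta)}\left[\sigma u_{i-k}^n+(1-\sigma)u_{i-k}^{n-1}\right]+f_i^{n-1+\sigma},\quad 1\le i\le M-1,\ 1\le n\le N,$$ $$u_0^n=0,\quad u_M^n=0,\quad 0\le n\le N,\qquad u_i^0=\phi(x_i),\quad 1\le i\le M-1.$$ Then $$\|u^n\|^2\le\|u^0\|^2+\frac{(2L)^\beta}{Kc_*^{(\beta)}\sum_{r=0}^{m}\frac{\lambda_r}{T^{\alpha_r}\Gamma(1-\alpha_r)}}\max_{1\le l\le n}\|f^{l-1+\sigma}\|^2,\quad 1\le n\le N,$$ where $\|u^n\|^2=h\sum_{i=1}^{M-1}(u_i^n)^2$ and $\|f^{l-1+\sigma}\|^2=h\sum_{i=1}^{M-1}\left(f_i^{l-1+\s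igma}\right)^2$.
   Context: Weight function: $\omega:[0,1]\to\mathbb{R}$ satisfies $\omega(\alpha)\ge 0$ and $\omega(\alpha)\ne0$ for $\alpha\in[0,1]$, and $0<\int_0^1\omega(\alpha)\,d\alpha<\infty$. Set $m=2J$, $\Delta\alpha=\frac1{2J}$, $\alpha_r=r\Delta\alpha$ for $0\le r\le m$, $d_0=d_m=\frac12$, $d_r=1$ for $1\le r\le m-1$, and $\lambda_r=d_r\omega(\alpha_r)\Delta\alpha>0$. $\sigma$ is the unique positive root (it lies in $[\frac12,1]$) of $$F(\sigma)=\sum_{r=0}^{m}\frac{\lambda_r}{\Gamma(3-\alpha_r)}\sigma^{1-\alpha_r}\left[\sigma-\left(1-\frac{\alpha_r}{2}\right)\right]\tau^{2-\alpha_r}=0 .$$ For $\alpha\in[0,1]$ let $a_0^{(\alpha)}=\sigma^{1-\alpha}$ and, for $l\ge1$, $a_l^{(\alpha)}=(l+\sigma)^{1-\alpha}-(l-1+\sigma)^{1-\alpha}$ and $$b_l^{(\alpha)}=\frac{1}{2-\alpha}\left[(l+\sigma)^{2-\alpha}-(l-1+\sigma)^{2-\alpha}\right]-\frac12\left[(l+\sigma)^{1-\alpha}+(l-1+\sigma)^{1-\alpha}\right].$$ Let $c_0^{(1,\alpha)}=a_0^{(\alpha)}$, and for $n\ge2$: $c_0^{(n,\alpha)}=a_0^{(\alpha)}+b_1^{(\alpha)}$; $c_k^{(n,\alpha)}=a_k^{(\alpha)}+b_{k+1}^{(\alpha)}-b_k^{(\alpha)}$ for $1\le k\le n-2$; $c_{n-1}^{(n,\alpha)}=a_{n-1}^{(\alpha)}-b_{n-1}^{(\alpha)}$.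 Define $$\hat c_k^{(n)}=\sum_{r=0}^{m}\lambda_r\frac{\tau^{-\alpha_r}}{\Gamma(2-\alpha_r)}c_k^{(n,\alpha_r)},\quad 0\le k\le n-1 .$$ For $k\in\mathbb{Z}$, $g_k^{(\beta)}=\dfrac{(-1)^k\Gamma(\beta+1)}{\Gamma(\beta/2-k+1)\Gamma(\beta/2+k+1)}$. The convention $1/\Gamma(z)=0$ at the poles of $\Gamma$ is used throughout (in particular $1/\Gamma(1-\alpha_m)=0$ since $\alpha_m=1$). The constant $c_*^{(\beta)}=\frac{2}{\beta}r_\beta$ with $$r_\beta=e^{-2}\frac{(4-\beta)(2-\beta)\beta}{(6+\beta)(4+\beta)(2+\beta)}\cdot\frac{\Gamma(\beta+1)}{\Gamma^2(\beta/2+1)}\left(3+\frac{\beta}{2}\right)^{\beta+1}.$$ For $\beta=2$ one has $c_*^{(\beta)}=0$; the coefficient $1/c_*^{(\beta)}$ is then read as $+\infty$, so the estimate carries no information in that case. *)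

(* Defs.v *)
From HB Require Import structures.
From mathcomp Require Import all_boot all_order all_algebra.
From mathcomp Require Import all_classical all_reals all_analysis.

Set Implicit Arguments.
Unset Strict Implicit.
Unset Printing Implicit Defensive.

Import Order.TTheory GRing.Theory Num.Theory.
Import numFieldNormedType.Exports.

Local Open Scope classical_set_scope.
Local Open Scope ring_scope.

(* Euler's integral, to be used for x > 0 only. *)
Definition Gamma (R : realType) (x : R) : R :=
  \int[@lebesgue_measure R]_(t in `]0, +oo[) (t `^ (x - 1) * expR (- t)).

(* The entire function 1 / Gamma on the real line, by
     1 / Gamma z = z (z + 1) ... (z + n - 1) / Gamma (z + n);
   by the functional equation of Gamma, every n with z + n > 0 gives the same
   value. At the poles z = 0, -1, -2, ... the product vanishes, so that the
   value is 0. *)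
Definition rGamma (R : realType) (z : R) : R :=
  let n := `|Num.floor z|%N.+1 in
  (\prod_(i < n) (z + i%:R)) / Gamma (z + n%:R).

Definition dalpha (R : realType) (J : nat) : R := (2 * J)%:R^-1.

Definition alpha (R : realType) (J r : nat) : R := r%:R * dalpha R J.

Definition trapezoid_weight (R : realType) (J r : nat) : R :=
  if (r == 0)%N || (r == 2 * J)%N then 2^-1 else 1.

Definition lambda (R : realType) (omega : R -> R) (J r : nat) : R :=
  trapezoid_weight R J r * omega (alpha R J r) * dalpha R J.

Definition F (R : realType) (omega : R -> R) (J : nat) (tau sigma : R) : R :=
  \sum_(0 <= r < (2 * J).+1)
    let al := alpha R J r in
    lambda omega J r / Gamma (3 - al) * sigma `^ (1 - al)
      * (sigma - (1 - al / 2)) * tau `^ (2 - al).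

Definition a (R : realType) (sigma al : R) (l : nat) : R :=
  if l == 0%N then sigma `^ (1 - al)
  else (l%:R + sigma) `^ (1 - al) - (l%:R - 1 + sigma) `^ (1 - al).

(* Only meaningful for 1 <= l. *)
Definition b (R : realType) (sigma al : R) (l : nat) : R :=
  (2 - al)^-1
    * ((l%:R + sigma) `^ (2 - al) - (l%:R - 1 + sigma) `^ (2 - al))
  - 2^-1 * ((l%:R + sigma) `^ (1 - al) + (l%:R - 1 + sigma) `^ (1 - al)).

(* Only meaningful for k < n. *)
Definition c (R : realType) (sigma al : R) (n k : nat) : R :=
  if n == 1%N then a sigma al 0
  else if k == 0%N then a sigma al 0 + b sigma al 1
  else if k == n.-1 then a sigma al k - b sigma al k
  else a sigma al k + b sigma al k.+1 - b sigma al k.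

Definition chat (R : realType) (omega : R -> R) (J : nat) (tau sigma : R)
    (n k : nat) : R :=
  \sum_(0 <= r < (2 * J).+1)
    let al := alpha R J r in
    lambda omega J r * (tau `^ (- al) / Gamma (2 - al)) * c sigma al n k.

Definition g (R : realType) (beta : R) (k : int) : R :=
  (-1) ^ k * Gamma (beta + 1)
    * rGamma (beta / 2 - k%:~R + 1) * rGamma (beta / 2 + k%:~R + 1).

Definition r_ (R : realType) (beta : R) : R :=
  expR (- 2)
    * ((4 - beta) * (2 - beta) * beta / ((6 + beta) * (4 + beta) * (2 + beta)))
    * (Gamma (beta + 1) / Gamma (beta / 2 + 1) ^+ 2)
    * (3 + beta / 2) `^ (beta + 1).

Definition cstar (R : realType) (beta : R) : R := 2 / beta * r_ beta.

Definition normsq (R : realType) (h : R) (M : nat) (v : nat -> R) : R :=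
  h * \sum_(1 <= i < M) v i ^+ 2.

(* Main.v *)
Require Import Defs.
From HB Require Import structures.
From mathcomp Require Import all_boot all_order all_algebra.
From mathcomp Require Import all_classical all_reals all_analysis.
From mathcomp Require Import measurable_realfun ring lra zify.

Set Implicit Arguments.
Unset Strict Implicit.
Unset Printing Implicit Defensive.

Import Order.TTheory GRing.Theory Num.Theory.
Import numFieldNormedType.Exports.

Local Open Scope classical_set_scope.
Local Open Scope ring_scope.

(** The proof is the energy method: test the scheme at level n with
    v_i = sigma u_i^n + (1 - sigma) u_i^(n-1) and sum over i.

    Space. The matrix g_(i-j) is symmetric with nonpositive off-diagonal
    entries, so its quadratic form is at least its smallest row sum times the
    sum of the v_i^2 ([quadratic_form_lb]). The g_k are alternating binomial
    coefficients, hence by Pascal's rule differences of an explicit product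
    ([riesz_tail]); a row sum is a sum of two such products, and Bernoulli's
    inequality shows that the product at p decays no faster than p^(-beta).
    This gives coercivity with constant cstar / (2M)^beta ([riesz_coercive]).

    Time. Write chat_k for the memory weights and V_k = (v - u^(n-k))^2.
    Pointwise in space,
      2 v (u^(n-k) - u^(n-k-1)) = (u^(n-k))^2 - (u^(n-k-1))^2 + V_(k+1) - V_k,
    so the test function produces the discrete derivative of u^2 plus
    sum_k chat_k (V_(k+1) - V_k). Summation by parts makes the last sum
    nonnegative as soon as chat_1 >= ... >= chat_(n-1) >= 0 and
    sigma^2 chat_1 <= (2 sigma - 1) chat_0, because
    V_1 - V_0 = (2 sigma - 1) (u^n - u^(n-1))^2 and
    V_1 = sigma^2 (u^n - u^(n-1))^2 ([energy_le]).

    The monotonicity holds for each fractional order separately, by concavity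
    of x |-> x^(1 - alpha). The condition on chat_0 and chat_1 does not: at
    order 0 it reads sigma^2 <= (2 sigma - 1) sigma, which fails for
    sigma < 1. What each order does satisfy is that its slack
    (2 sigma - 1) c_0 - sigma^2 c_1 is at least
    2 / (2 - alpha) sigma^(1 - alpha) (sigma - (1 - alpha / 2)), with equality
    at the orders 0 and 1 when n > 2 ([two_step_inequality]). Weighted as in
    chat, these bounds add up to a multiple of F(sigma) = 0, which gives the
    condition for chat ([chat_two_step]).

    Conclusion. Young's inequality absorbs the source term into the coercive
    term, leaving an inequality for the squared norms with memory weights chat
    ([level_energy]). As chat is nonincreasing and its last weight is at least
    half of the rate in the denominator of the claim ([chat_last_lb]), an
    induction on the level bounds the norm ([memory_gronwall]). *)

(** * Power functions with exponent in [0, 1] *)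

(** Bernoulli's inequality, homogenized: the concave function x^p lies below
    its tangent at y. All the estimates on powers below come from it. *)
Lemma powR_le_tangent (R : realType) (p x y : R) :
  0 <= p <= 1 -> 0 < x -> 0 < y -> x `^ p <= y `^ p * (1 + p * (x / y - 1)).
Proof.
move=> /andP[p0 p1] x0 y0.
have [->|pN0] := eqVneq p 0; first by rewrite !powRr0; lra.
have [->|pN1] := eqVneq p 1.
  rewrite !powRr1 ?(ltW x0) ?(ltW y0)// (_ : y * _ = x)//.
  by field; rewrite gt_eqF.
have {}p0 : 0 < p by lra.
have q0 : 0 < 1 - p by lra.
have xy0 : 0 < x / y by rewrite divr_gt0.
(* Young's inequality for (x / y)^p and 1 with exponents 1/p and 1/(1-p). *)
have := @conjugate_powR R ((x / y) `^ p) 1 p^-1 (1 - p)^-1 (powR_ge0 _ _) ler01.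
rewrite !invr_gt0 !invrK powR1 -powRrM divff ?gt_eqF// powRr1 ?(ltW xy0)//.
move=> /(_ p0 q0 (subrKC _ _)) H.
rewrite -{1}(divfK (lt0r_neq0 y0) x) powRM ?(ltW xy0) ?(ltW y0)//.
rewrite mulrC ler_pM2l ?powR_gt0//.
lra.
Qed.

Lemma is_derive_powRD (R : realType) (p c x : R) : 0 < x + c ->
  is_derive x 1 (fun z => (z + c) `^ p) (p * (x + c) `^ (p - 1)).
Proof.
move=> xc.
have d1 : is_derive x 1 (fun z : R => z + c) 1.
  by apply: (is_derive_eq (is_deriveD _ _)); rewrite ?addr0.
have d2 := is_derive1_powR p xc.
have := @is_derive1_comp R (fun z => z `^ p) (fun z => z + c) x _ _ d2 d1.
by rewrite mulr1 => d; exact: d.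
Qed.

Lemma ge0_is_derive_le (R : realType) (f df : R -> R) (a b : R) : a <= b ->
  (forall x, a <= x <= b -> is_derive x 1 f (df x)) ->
  (forall x, a <= x <= b -> 0 <= df x) -> f a <= f b.
Proof.
move=> ab fd df0; rewrite -subr_ge0.
have [||c] := @MVT_segment R f df a b ab.
- by move=> x; rewrite in_itv/= => /andP[ax xb]; apply: fd; rewrite !ltW.
- apply: derivable_within_continuous => x; rewrite in_itv/= => xab.
  by have [] := fd _ xab.
by rewrite in_itv/= => cab ->; rewrite mulr_ge0 ?subr_ge0// df0.
Qed.
(** Every auxiliary function below is a nested combination
    k1 f1 + (k2 f2 + (... + 0)) of shifted powers, so that this lemma and
    [is_derive_powRD] are all that is needed to differentiate it. *)
Lemma is_derive_axpy (R : realType) (f g : R -> R) (k x df dg : R) :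
  is_derive x 1 f df -> is_derive x 1 g dg ->
  is_derive x 1 (fun z => k * f z + g z) (k * df + dg).
Proof. by move=> f' g'; exact: (is_deriveD (is_deriveZ k f') g'). Qed.

Lemma powRS (R : realType) (p x : R) : 0 < x -> x `^ (p + 1) = x * x `^ p.
Proof.
move=> x0; rewrite powRD; last by rewrite (gt_eqF x0) implybT.
by rewrite powRr1 ?(ltW x0)// mulrC.
Qed.

Lemma powR_pred (R : realType) (p x : R) : 0 < x -> x `^ p = x * x `^ (p - 1).
Proof. by move=> x0; rewrite -powRS// subrK. Qed.

Lemma powR_ge_chord (R : realType) (p x y : R) : 0 <= p <= 1 -> 0 < y -> 0 < x ->
  p * (x - y) * x `^ (p - 1) <= x `^ p - y `^ p.
Proof.
move=> p01 y0 x0; have := powR_le_tangent p01 y0 x0.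
have -> : x `^ p * (1 + p * (y / x - 1))
    = x `^ p - p * (x - y) * (x `^ p / x).
  by field; rewrite gt_eqF.
have -> : x `^ p / x = x `^ (p - 1).
  by rewrite (powR_pred p x0) [x * _]mulrC mulfK ?gt_eqF.
lra.
Qed.

(** The trapezoidal rule underestimates the integral of a concave function:
    as a function of x, the difference of the two sides has a nonnegative
    derivative by [powR_ge_chord]. *)
Lemma powR_trapezoid (R : realType) (p x y : R) : 0 <= p <= 1 -> 0 < y -> y <= x ->
  (x - y) / 2 * (x `^ p + y `^ p)
    <= (p + 1)^-1 * (x `^ (p + 1) - y `^ (p + 1)).
Proof.
move=> p01 y0 yx; have p1 : p + 1 != 0 by lra.
pose f (z : R) := ((p + 1)^-1 - 2^-1) * (z + 0) `^ (p + 1)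
  + (2^-1 * y * (z + 0) `^ p + (- (2^-1 * y `^ p) * (z + 0) `^ 1 + 0)).
have fE (z : R) : 0 < z -> f z = (p + 1)^-1 * z `^ (p + 1)
    - (z - y) / 2 * (z `^ p + y `^ p) - 2^-1 * y * y `^ p.
  move=> z0; rewrite /f !addr0 !powRS// powRr1 ?(ltW z0)//; ring.
have x0 : 0 < x by lra.
have : f y <= f x.
  apply: (@ge0_is_derive_le _ _ (fun z => ((p + 1)^-1 - 2^-1)
      * ((p + 1) * (z + 0) `^ (p + 1 - 1))
    + (2^-1 * y * (p * (z + 0) `^ (p - 1))
    + (- (2^-1 * y `^ p) * (1 * (z + 0) `^ (1 - 1)) + 0))))
    => [//|z|z] /andP[yz zx].
    have z0 : 0 < z + 0 by lra.
    do 3 (apply: is_derive_axpy; first exact: is_derive_powRD).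
  have z0 : 0 < z by lra.
  rewrite addr0 addrK subrr powRr0.
  have -> : ((p + 1)^-1 - 2^-1) * ((p + 1) * z `^ p)
    + (2^-1 * y * (p * z `^ (p - 1)) + (- (2^-1 * y `^ p) * (1 * 1) + 0))
    = 2^-1 * (z `^ p - y `^ p - p * (z - y) * z `^ (p - 1)).
    by rewrite (powR_pred p z0); field.
  by rewrite mulr_ge0// subr_ge0 powR_ge_chord.
by rewrite !fE// !powRS//; lra.
Qed.

(** The convex function x^(p-1) lies above its tangent; with w the relative
    increment of [powR_le_tangent] at exponent 1 - p, this is
    (1 - w) (1 + w) <= 1. *)
Lemma powR_sub1_convex (R : realType) (p x y : R) : 0 <= p <= 1 -> 0 < y -> 0 < x ->
  x `^ (p - 1) + (1 - p) * (x - y) * x `^ (p - 2) <= y `^ (p - 1).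
Proof.
move=> p01 y0 x0; have q01 : 0 <= 1 - p <= 1 by lra.
have := powR_le_tangent q01 y0 x0.
have -> : p - 2 = p - 1 - 1 by ring.
have -> : x `^ (p - 1 - 1) = x `^ (p - 1) / x.
  by rewrite (powR_pred (p - 1) x0) [x * _]mulrC mulfK ?gt_eqF.
have E z : z `^ (p - 1) = (z `^ (1 - p))^-1 by rewrite -powRN opprB.
rewrite !E.
have Y0 := powR_gt0 (1 - p) y0; have X0 := powR_gt0 (1 - p) x0.
set Y := y `^ (1 - p) in Y0 *; set X := x `^ (1 - p) in X0 *.
set w := (1 - p) * (y / x - 1) => H.
have -> : X^-1 + (1 - p) * (x - y) * (X^-1 / x) = (1 - w) / X.
  by rewrite /w; field; rewrite !gt_eqF.
rewrite ler_pdivrMr// mulrC ler_pdivlMr//.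
have [w1|w1] := lerP (1 - w) 0; first by nra.
have : (1 - w) * Y <= (1 - w) * (X * (1 + w)) by rewrite ler_wpM2l// ltW.
have : 0 <= X * w ^+ 2 by rewrite mulr_ge0 ?sqr_ge0 ?(ltW X0).
lra.
Qed.

(** The trapezoidal rule overestimates the integral of the convex derivative
    p x^(p-1). *)
Lemma powR_diff_trapezoid (R : realType) (p x y : R) :
  0 <= p <= 1 -> 0 < y -> y <= x ->
  x `^ p - y `^ p <= p * (x - y) / 2 * (x `^ (p - 1) + y `^ (p - 1)).
Proof.
move=> p01 y0 yx.
pose f (z : R) := (p / 2 - 1) * (z + 0) `^ p
  + (- (p / 2) * y * (z + 0) `^ (p - 1)
  + ((p / 2) * y `^ (p - 1) * (z + 0) `^ 1 + 0)).
have fE (z : R) : 0 < z -> f z = p * (z - y) / 2 * (z `^ (p - 1) + y `^ (p - 1))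
    - z `^ p + p / 2 * y * y `^ (p - 1).
  by move=> z0; rewrite /f !addr0 (powR_pred p z0) powRr1 ?(ltW z0)//; field.
have x0 : 0 < x by lra.
have : f y <= f x.
  apply: (@ge0_is_derive_le _ _ (fun z => (p / 2 - 1) * (p * (z + 0) `^ (p - 1))
    + (- (p / 2) * y * ((p - 1) * (z + 0) `^ (p - 1 - 1))
    + ((p / 2) * y `^ (p - 1) * (1 * (z + 0) `^ (1 - 1)) + 0))))
    => [//|z|z] /andP[yz zx].
    have z0 : 0 < z + 0 by lra.
    do 3 (apply: is_derive_axpy; first exact: is_derive_powRD).
  have z0 : 0 < z by lra.
  rewrite addr0 subrr powRr0.
  have := powR_sub1_convex p01 y0 z0.
  have -> : p - 2 = p - 1 - 1 by ring.
  rewrite (powR_pred (p - 1) z0); move: (_ `^ (p - 1 - 1)) (y `^ _) => A B H.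
  have p0 : 0 <= p / 2 by lra.
  have : 0 <= p / 2 * (B - (z * A + (1 - p) * (z - y) * A)).
    by rewrite mulr_ge0// subr_ge0.
  lra.
by rewrite !fE// (powR_pred p y0) (powR_pred p x0); lra.
Qed.
Lemma powRS_diff_le (R : realType) (p x y : R) : 0 <= p -> 0 < y -> y <= x ->
  (p + 1)^-1 * (x `^ (p + 1) - y `^ (p + 1)) <= (x - y) * x `^ p.
Proof.
move=> p0 y0 yx; have x0 : 0 < x by lra.
pose f (z : R) := - (p + 1)^-1 * (z + 0) `^ (p + 1)
  + (x `^ p * (z + 0) `^ 1 + 0).
have : f y <= f x.
  apply: (@ge0_is_derive_le _ _ (fun z => - (p + 1)^-1
      * ((p + 1) * (z + 0) `^ (p + 1 - 1))
    + (x `^ p * (1 * (z + 0) `^ (1 - 1)) + 0))) => [//|z|z] /andP[yz zx].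
    have z0 : 0 < z + 0 by lra.
    by do 2 (apply: is_derive_axpy; first exact: is_derive_powRD).
  rewrite addr0 addrK subrr powRr0.
  have -> : - (p + 1)^-1 * ((p + 1) * z `^ p) + (x `^ p * (1 * 1) + 0)
    = x `^ p - z `^ p by field; lra.
  by rewrite subr_ge0 ge0_ler_powR// nnegrE; lra.
by rewrite /f !addr0 !powRr1; lra.
Qed.

(** * Coefficients of a single fractional order *)

(** The trapezoidal error of z^p over a unit interval is an integral of
    -(z^p)'', which decreases, against a positive kernel. Its derivative in z
    is the error of the rule for p z^(p-1), whose sign is
    [powR_diff_trapezoid]. With p = 1 - al, this error is the coefficient b. *)
Lemma trapezoid_error_nincr (R : realType) (p x x' : R) :
  0 <= p <= 1 -> 1 < x -> x <= x' ->
  let e (z : R) := (p + 1)^-1 * (z `^ (p + 1) - (z - 1) `^ (p + 1))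
    - 2^-1 * (z `^ p + (z - 1) `^ p) in
  e x' <= e x.
Proof.
move=> p01 x1 xx'; have p1 : p + 1 != 0 by lra.
pose f (z : R) := - (p + 1)^-1 * (z + 0) `^ (p + 1)
  + ((p + 1)^-1 * (z + - 1) `^ (p + 1)
  + (2^-1 * (z + 0) `^ p + (2^-1 * (z + - 1) `^ p + 0))).
suff : f x <= f x' by rewrite /f !addr0 /=; lra.
apply: (@ge0_is_derive_le _ _ (fun z : R =>
  - (p + 1)^-1 * ((p + 1) * (z + 0) `^ (p + 1 - 1))
  + ((p + 1)^-1 * ((p + 1) * (z + - 1) `^ (p + 1 - 1))
  + (2^-1 * (p * (z + 0) `^ (p - 1))
  + (2^-1 * (p * (z + - 1) `^ (p - 1)) + 0))))) => [//|z|z] /andP[xz zx].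
  by do 4 (apply: is_derive_axpy; first by apply: is_derive_powRD; lra).
have := @powR_diff_trapezoid R p z (z - 1) p01 ltac:(lra) ltac:(lra).
rewrite addr0 !addrK !mulrA !mulNr mulVf//.
by lra.
Qed.

(** The same for the coefficient a - b, the integral of the decreasing function
    (z^p)' against the positive kernel 1/2 + y, where y in [0, 1] is the
    position in the interval. *)
Lemma trapezoid_excess_nincr (R : realType) (p x x' : R) :
  0 <= p <= 1 -> 1 < x -> x <= x' ->
  let e (z : R) := z `^ p - (z - 1) `^ p
    - ((p + 1)^-1 * (z `^ (p + 1) - (z - 1) `^ (p + 1))
       - 2^-1 * (z `^ p + (z - 1) `^ p)) in
  e x' <= e x.
Proof.
move=> p01 x1 xx'; have p1 : p + 1 != 0 by lra.
pose f (z : R) := (p + 1)^-1 * (z + 0) `^ (p + 1)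
  + (- (p + 1)^-1 * (z + - 1) `^ (p + 1)
  + (- (3 / 2) * (z + 0) `^ p + (2^-1 * (z + - 1) `^ p + 0))).
suff : f x <= f x' by rewrite /f !addr0 /=; lra.
apply: (@ge0_is_derive_le _ _ (fun z : R =>
  (p + 1)^-1 * ((p + 1) * (z + 0) `^ (p + 1 - 1))
  + (- (p + 1)^-1 * ((p + 1) * (z + - 1) `^ (p + 1 - 1))
  + (- (3 / 2) * (p * (z + 0) `^ (p - 1))
  + (2^-1 * (p * (z + - 1) `^ (p - 1)) + 0))))) => [//|z|z] /andP[xz zx].
  by do 4 (apply: is_derive_axpy; first by apply: is_derive_powRD; lra).
have z0 : 0 < z by lra.
have y0 : 0 < z - 1 by lra.
have H := powR_ge_chord p01 y0 z0.
have H' := powR_sub1_convex p01 y0 z0.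
have : 0 <= (1 - p) * (z - (z - 1)) * z `^ (p - 2).
  by rewrite !mulr_ge0 ?powR_ge0//; lra.
move: H H'; rewrite addr0 !addrK !mulrA !mulNr mulVf// !mul1r.
move: (z `^ (p - 1)) ((z - 1) `^ (p - 1)) (z `^ (p - 2)) => A B C H1 H2 H3.
have BA : A <= B by lra.
have : 0 <= p * (B - A) by rewrite mulr_ge0//; lra.
by lra.
Qed.

Section coefficients.
Variables (R : realType) (s al : R).

Let nodes l : 0 < s -> (0 < l)%N ->
  (0 < l%:R - 1 + s) /\ (l%:R - 1 + s < l%:R + s).
Proof.
by move=> s0; rewrite -[(0 < l)%N](ler_nat R 1) => l1; split; lra.
Qed.

Let orderS : 2 - al = 1 - al + 1. Proof. by ring. Qed.

Lemma b_ge0 l : 0 < s -> 0 <= al <= 1 -> (0 < l)%N -> 0 <= b s al l.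
Proof.
move=> s0 al01 /(nodes s0)[y0 yx]; have p01 : 0 <= 1 - al <= 1 by lra.
have := powR_trapezoid p01 y0 (ltW yx).
by rewrite /b orderS; lra.
Qed.

Lemma b_nincr l : 0 < s -> 0 <= al <= 1 -> (0 < l)%N ->
  b s al l.+1 <= b s al l.
Proof.
move=> s0 al01 /(nodes s0)[y0 yx]; have p01 : 0 <= 1 - al <= 1 by lra.
have := @trapezoid_error_nincr R (1 - al) (l%:R + s) (l.+1%:R + s) p01.
rewrite /b orderS /= -natr1 => /(_ ltac:(lra) ltac:(lra)).
by rewrite ![_ - 1 + s]addrAC; lra.
Qed.

Lemma sub_ab_nincr l : 0 < s -> 0 <= al <= 1 -> (0 < l)%N ->
  a s al l.+1 - b s al l.+1 <= a s al l - b s al l.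
Proof.
move=> s0 al01 l0; have [y0 yx] := nodes s0 l0.
have p01 : 0 <= 1 - al <= 1 by lra.
have := @trapezoid_excess_nincr R (1 - al) (l%:R + s) (l.+1%:R + s) p01.
rewrite /a /b -if_neg -lt0n l0 orderS /= -natr1 => /(_ ltac:(lra) ltac:(lra)).
by rewrite ![_ - 1 + s]addrAC; lra.
Qed.

Lemma sub_ab_lb l : 0 < s -> 0 <= al <= 1 -> (0 < l)%N ->
  (1 - al) / 2 * (l%:R + s) `^ (- al) <= a s al l - b s al l.
Proof.
move=> s0 al01 l0; have [y0 yx] := nodes s0 l0.
have p01 : 0 <= 1 - al <= 1 by lra.
have x0 : 0 < l%:R + s by lra.
have /andP[p0 _] := p01.
have := powRS_diff_le p0 y0 (ltW yx).
have := powR_ge_chord p01 y0 x0.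
have -> : 1 - al - 1 = - al by ring.
rewrite /a /b -if_neg -lt0n l0 orderS.
have -> : l%:R + s - (l%:R - 1 + s) = 1 by ring.
lra.
Qed.

(** For 0 < k, c_k - c_(k+1) is the decrease of a - b from k to k+1 plus the
    decrease of b from k+1 to k+2, or plus b_(k+1) itself when k+1 is the last
    index. *)
Lemma c_nincr n k : 0 < s -> 0 <= al <= 1 -> (0 < k)%N -> (k.+1 < n)%N ->
  c s al n k.+1 <= c s al n k.
Proof.
move=> s0 al01 k0 kn; rewrite /c.
have -> : (n == 1%N) = false by apply/eqP; lia.
have b2 := b_ge0 s0 al01 (isT : (0 < k.+2)%N).
have b1 := b_ge0 s0 al01 (isT : (0 < k.+1)%N).
have bb := b_nincr s0 al01 (isT : (0 < k.+1)%N).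
have ab := sub_ab_nincr s0 al01 k0.
have -> : (k == 0%N) = false by apply/eqP; lia.
have -> : (k == n.-1) = false by apply/eqP; lia.
by case: ifP => _ /=; lra.
Qed.

(** The last weight dominates half the derivative of x^(1-al) at the far end of
    the oldest interval: this is what survives in the rate of the final
    estimate. *)
Lemma c_last_lb n : 2^-1 <= s -> 0 <= al <= 1 -> (0 < n)%N ->
  (1 - al) / 2 * (n%:R - 1 + s) `^ (- al) <= c s al n n.-1.
Proof.
move=> s2 al01; have s0 : 0 < s by lra.
case: n => [//|[_|n _]] /=.
  have -> : 1 - 1 + s = s :> R by ring.
  rewrite /c /a /=; have -> : 1 - al = - al + 1 by ring.
  rewrite powRS// ler_wpM2r ?powR_ge0//; lra.
rewrite /c /= eqxx; have := sub_ab_lb s0 al01 (isT : (0 < n.+1)%N).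
by rewrite -[n.+2%:R]natr1 addrK.
Qed.

Lemma c0_ge0 n : 0 < s -> 0 <= al <= 1 -> 0 <= c s al n 0.
Proof.
move=> s0 al01; rewrite /c; case: ifP => _; first exact: powR_ge0.
by rewrite addr_ge0 ?powR_ge0 ?b_ge0.
Qed.

(** The right-hand side is the slack (2 s - 1) c_0 - s^2 c_1 of a single order,
    the left-hand side its contribution to F(s) up to common factors. With
    p = 1 - al and A, B, C the p-th powers of s, 1 + s, 2 + s, the claim is
      A (p + 1 - 2s) (1 + s)^2 + B (1 + 2s - p) (2s^2 + 2s - 1)
        >= s^2 C (3 + 2s - p),
    an equality for p = 0 and p = 1. Bernoulli's inequality compares A and C
    with B, and the resulting polynomial has the factor p (1 - p). *)
Lemma two_step_inequality : 2^-1 <= s <= 1 -> 0 <= al <= 1 ->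
  2 / (2 - al) * s `^ (1 - al) * (s - (1 - al / 2))
    <= (2 * s - 1) * (a s al 0 + b s al 1)
       - s ^+ 2 * (a s al 1 + b s al 2 - b s al 1).
Proof.
move=> s01 al01; have p01 : 0 <= 1 - al <= 1 by lra.
have s_gt0 : 0 < s by lra.
have s1 : 0 < 1 + s by lra.
have s2 : 0 < 2 + s by lra.
have HC := powR_le_tangent p01 s2 s1.
have HA := powR_le_tangent p01 s_gt0 s1.
(* A lower bound for A: the tangent at s instead of at 1 + s. *)
have HA' : (1 + s) `^ (1 - al) * s <= s `^ (1 - al) * (s + (1 - al)).
  have := powR_le_tangent p01 s1 s_gt0.
  rewrite -(ler_pM2r s_gt0).
  by have -> : s `^ (1 - al) * (1 + (1 - al) * ((1 + s) / s - 1)) * s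
    = s `^ (1 - al) * (s + (1 - al)) by field; rewrite gt_eqF.
rewrite /a /b /= !orderS.
have -> : 1 - 1 + s = s :> R by ring.
have -> : 2 - 1 + s = 1 + s :> R by ring.
rewrite !powRS//.
move: HC HA HA' p01 {al01}; have -> : 1 - al / 2 = ((1 - al) + 1) / 2 by field.
move: (1 - al) => p.
move: (s `^ p) (powR_gt0 p s_gt0) => A A0.
move: ((1 + s) `^ p) (powR_gt0 p s1) => B B0.
move: ((2 + s) `^ p) (powR_gt0 p s2) => C C0 HC HA HA' {}p01.
have {}HC : (1 + s) * C <= B * (1 + s + p).
  have -> : B * (1 + s + p) = (1 + s) * (B * (1 + p * ((2 + s) / (1 + s) - 1))).
    by field; rewrite gt_eqF.
  by rewrite ler_pM2l.
have {}HA : (1 + s) * A <= B * (1 + s - p).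
  have -> : B * (1 + s - p) = (1 + s) * (B * (1 + p * (s / (1 + s) - 1))).
    by field; rewrite gt_eqF.
  by rewrite ler_pM2l.
have p1 : 0 < p + 1 by lra.
rewrite -subr_ge0.
have -> : (2 * s - 1) * (A + ((p + 1)^-1 * ((1 + s) * B - s * A) - 2^-1 * (B + A)))
  - s ^+ 2 * (B - A + ((p + 1)^-1 * ((2 + s) * C - (1 + s) * B) - 2^-1 * (C + B))
    - ((p + 1)^-1 * ((1 + s) * B - s * A) - 2^-1 * (B + A)))
  - 2 / (p + 1) * A * (s - (p + 1) / 2)
  = (2 * (p + 1))^-1 * (A * (p + 1 - 2 * s) * (1 + s) ^+ 2
    + B * (1 + 2 * s - p) * (2 * s ^+ 2 + 2 * s - 1)
    - s ^+ 2 * C * (3 + 2 * s - p)).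
  by field; rewrite gt_eqF.
rewrite mulr_ge0 ?invr_ge0//; first by lra.
have HC' : s ^+ 2 * (3 + 2 * s - p) * ((1 + s) * C)
    <= s ^+ 2 * (3 + 2 * s - p) * (B * (1 + s + p)).
  by rewrite ler_wpM2l// mulr_ge0 ?sqr_ge0//; lra.
rewrite -(pmulr_rge0 _ s1).
have Bp : 0 <= B * (p * (1 - p)) by rewrite !mulr_ge0 ?(ltW B0)//; lra.
(* The sign of the coefficient of A decides which bound on A is needed. *)
have [ps|ps] := lerP (p + 1 - 2 * s) 0.
  have H : 0 <= (2 * s - 1 - p) * (1 + s) ^+ 2 * (B * (1 + s - p) - (1 + s) * A).
    by rewrite !mulr_ge0 ?sqr_ge0// ?subr_ge0//; lra.
  have : 0 <= B * (p * (1 - p)) * (1 + 2 * s) by rewrite mulr_ge0//; lra.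
  lra.
have sp : 0 < s + p by lra.
rewrite -(pmulr_rge0 _ sp).
have H : 0 <= (p + 1 - 2 * s) * (1 + s) ^+ 3 * (A * (s + p) - B * s).
  by rewrite !mulr_ge0 ?exprn_ge0// ?subr_ge0//; lra.
have {}HC' : 0 <= (s + p) * (s ^+ 2 * (3 + 2 * s - p) * (B * (1 + s + p))
    - s ^+ 2 * (3 + 2 * s - p) * ((1 + s) * C)).
  by rewrite mulr_ge0 ?subr_ge0//; lra.
have : 0 <= B * (p * (1 - p))
    * ((1 + 2 * s) * (s + p) - (1 + s) ^+ 2 * (p + 1 - 2 * s)).
  rewrite mulr_ge0//.
  have : 0 <= (1 - p) * s ^+ 2 by rewrite mulr_ge0 ?sqr_ge0//; lra.
  have : 0 <= s * (s - 2^-1) by rewrite mulr_ge0//; lra.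
  have : 0 <= s ^+ 3 by rewrite exprn_ge0// ltW.
  lra.
lra.
Qed.
End coefficients.
(** * Discrete energy estimates *)

(** Summation by parts. It is applied to the squares (v - u^(n-k))^2 in
    [energy_le] and to the gaps to the claimed bound in [memory_gronwall]. *)
Lemma abel_nincr (R : realDomainType) (w V : nat -> R) (m n : nat) :
  (m < n)%N -> (forall k, (m <= k)%N -> (k.+1 < n)%N -> w k.+1 <= w k) ->
  (forall k, (m < k < n)%N -> 0 <= V k) ->
  w n.-1 * V n - w m * V m <= \sum_(m <= k < n) w k * (V k.+1 - V k).
Proof.
elim: n => // n IHn; rewrite ltnS leq_eqVlt => /predU1P[-> _ _|mn w_nincr V0].
  by rewrite big_nat1 mulrBr.
rewrite big_nat_recr/=; last exact: ltnW.
have /IHn : forall k, (m <= k)%N -> (k.+1 < n)%N -> w k.+1 <= w k.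
  by move=> k mk kn; apply: w_nincr => //; lia.
move=> /(_ mn) IH; have {IH} : w n.-1 * V n - w m * V m
    <= \sum_(m <= k < n) w k * (V k.+1 - V k).
  by apply: IH => k mkn; apply: V0; lia.
have : w n * V n <= w n.-1 * V n.
  rewrite ler_wpM2r//; first by apply: V0; lia.
  by have := w_nincr n.-1; rewrite prednK; [apply; lia|lia].
lra.
Qed.

(** The difference of the two sides is the sum of w_k (V_(k+1) - V_k) with
    V_k = (v - U_(n-k))^2. The summation by parts starts at k = 1, where it
    loses w_1 V_1 = s^2 w_1 d^2 with d = U_n - U_(n-1); the term k = 0
    provides (2s - 1) w_0 d^2. *)
Lemma energy_le (R : realFieldType) (w U : nat -> R) (s : R) (n : nat) :
  (0 < n)%N -> 2^-1 <= s -> 0 <= w 0%N -> 0 <= w n.-1 ->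
  (forall k, (0 < k)%N -> (k.+1 < n)%N -> w k.+1 <= w k) ->
  ((1 < n)%N -> s ^+ 2 * w 1%N <= (2 * s - 1) * w 0%N) ->
  \sum_(0 <= k < n) w k * (U (n - k)%N ^+ 2 - U (n - k - 1)%N ^+ 2)
    <= 2 * (s * U n + (1 - s) * U (n - 1)%N)
       * \sum_(0 <= k < n) w k * (U (n - k)%N - U (n - k - 1)%N).
Proof.
move=> n0 s2 w0 wn w_nincr w01.
pose v := s * U n + (1 - s) * U (n - 1)%N.
pose V k := (v - U (n - k)%N) ^+ 2.
rewrite -/v -subr_ge0 mulr_sumr -sumrB.
rewrite (eq_bigr (fun k => w k * (V k.+1 - V k))); last first.
  by move=> k _; rewrite /V -(addn1 k) subnDA; ring.
rewrite big_ltn//.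
have -> : V 1%N - V 0%N = (2 * s - 1) * (U n - U (n - 1)%N) ^+ 2.
  by rewrite /V /v subn0; ring.
have [n1|n1] := leqP n 1.
  by rewrite big_geq// addr0 mulr_ge0// mulr_ge0 ?sqr_ge0//; lra.
have := @abel_nincr _ w V 1 n n1 w_nincr (fun k _ => sqr_ge0 _).
have : 0 <= w n.-1 * V n by rewrite mulr_ge0 ?sqr_ge0.
have -> : w 1%N * V 1%N = s ^+ 2 * w 1%N * (U n - U (n - 1)%N) ^+ 2.
  by rewrite /V /v; ring.
have := ler_wpM2r (sqr_ge0 (U n - U (n - 1)%N)) (w01 n1).
lra.
Qed.

(** Solved for E_n, the inequality bounds w_0 E_n by a combination of the
    earlier E_j with nonnegative coefficients of sum w_0, plus d Phi; the
    coefficient of E_0 is the last weight, which is at least d, so E_0 can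
    absorb Phi. *)
Lemma memory_gronwall (R : realFieldType) (w : nat -> nat -> R) (E : nat -> R)
    (N : nat) (d Phi : R) :
  0 < d -> 0 <= Phi ->
  (forall n k, (k.+1 < n <= N)%N -> w n k.+1 <= w n k) ->
  (forall n, (0 < n <= N)%N -> d <= w n n.-1) ->
  (forall n, (0 < n <= N)%N ->
    \sum_(0 <= k < n) w n k * (E (n - k)%N - E (n - k - 1)%N) <= d * Phi) ->
  forall n, (n <= N)%N -> E n <= E 0%N + Phi.
Proof.
move=> d0 Phi0 w_nincr w_lb wE; elim/ltn_ind => -[_ _|n IHn nN].
  by rewrite lerDl.
pose V k := E 0%N + Phi - E (n.+1 - k)%N.
have H : w n.+1 n * V n.+1 - w n.+1 0%N * V 0%N
    <= \sum_(0 <= k < n.+1) w n.+1 k * (V k.+1 - V k).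
  apply: (abel_nincr (n := n.+1)) => // [k _ kn|k /andP[k0 kn]].
    by apply: w_nincr; rewrite kn.
  by rewrite subr_ge0 IHn//; lia.
move: H.
rewrite (eq_bigr (fun k => w n.+1 k * (E (n.+1 - k)%N - E (n.+1 - k - 1)%N))).
  2: by move=> k _; rewrite /V -(addn1 k) subnDA; ring.
have := wE n.+1 nN; rewrite /V subnn subn0.
have w0_ge k : (k <= n)%N -> w n.+1 k <= w n.+1 0%N.
  elim: k => // k IHk kn; apply: le_trans (IHk (ltnW kn)).
  by apply: w_nincr; rewrite ltnS kn.
have := w0_ge n (leqnn n); have := w_lb n.+1 nN; rewrite /=.
move: (\sum_(_ <= _ < _) _) => X dw w0 XPhi.
have : d * Phi <= w n.+1 n * Phi by rewrite ler_wpM2r.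
move=> H1 H2; rewrite -subr_ge0 -(@pmulr_rge0 _ (w n.+1 0%N)); first by lra.
lra.
Qed.

(** Diagonal dominance, from B_ij (v_i - v_j)^2 <= 0 for i <> j. *)
Lemma quadratic_form_lb (R : realFieldType) (I : eqType) (r : seq I)
    (B : I -> I -> R) (d : R) (v : I -> R) :
  (forall i j, B i j = B j i) -> (forall i j, i != j -> B i j <= 0) ->
  (forall i, i \in r -> d <= \sum_(j <- r) B i j) ->
  d * (\sum_(i <- r) v i ^+ 2)
    <= \sum_(i <- r) v i * \sum_(j <- r) B i j * v j.
Proof.
move=> B_sym B_off B_row.
have E : \sum_(i <- r) \sum_(j <- r) B i j * v j ^+ 2
    = \sum_(i <- r) \sum_(j <- r) B i j * v i ^+ 2.
  rewrite exchange_big/=; apply: eq_bigr => j _; apply: eq_bigr => i _.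
  by rewrite B_sym.
apply: (@le_trans _ _ (\sum_(i <- r) \sum_(j <- r) B i j * v i ^+ 2)).
  rewrite mulr_sumr !big_seq; apply: ler_sum => i ir.
  by rewrite -mulr_suml ler_wpM2r ?sqr_ge0 ?B_row.
have : \sum_(i <- r) \sum_(j <- r)
    (B i j * v i ^+ 2 + B i j * v j ^+ 2) / 2
    <= \sum_(i <- r) v i * \sum_(j <- r) B i j * v j.
  apply: ler_sum => i _; rewrite mulr_sumr; apply: ler_sum => j _.
  have [->|ij] := eqVneq i j; first by lra.
  have : 0 <= - B i j * (v i - v j) ^+ 2.
    by rewrite mulr_ge0 ?sqr_ge0// oppr_ge0 B_off.
  lra.
rewrite (eq_bigr (fun i => (\sum_(j <- r) B i j * v i ^+ 2) / 2
    + (\sum_(j <- r) B i j * v j ^+ 2) / 2)); last first.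
  by move=> i _; rewrite -mulr_suml big_split/= mulrDl.
by rewrite big_split/= -!mulr_suml E -splitr.
Qed.
(** * The Gamma function on [1, +oo[ *)

Section Gamma_ge1.
Variable R : realType.
Implicit Types x y t C : R.
Let mu := @lebesgue_measure R.

(** The constant (2 (x + 1))^x comes from t / (2 (x + 1)) <= exp (t / (2 (x + 1)))
    raised to the power x. *)
Lemma powR_expRN_le x : 0 <= x -> exists2 C, 0 < C &
  forall t, 0 <= t -> t `^ x * expR (- t) <= C * expR (- (2^-1 * t)).
Proof.
move=> x0; have X0 : 0 < 2 * (x + 1) by lra.
exists ((2 * (x + 1)) `^ x); first exact: powR_gt0.
move=> t t0; have tX0 : 0 <= t / (2 * (x + 1)) by rewrite divr_ge0// ltW.
have H : (t / (2 * (x + 1))) `^ x <= expR (2^-1 * t).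
  apply: (@le_trans _ _ (expR (t / (2 * (x + 1)) * x))).
    rewrite expRM ge0_ler_powR ?nnegrE ?expR_ge0//.
    by apply: le_trans (expR_ge1Dx _); rewrite lerDr.
  rewrite ler_expR mulrC mulrCA [leRHS]mulrC ler_wpM2l// ler_pdivrMr//; lra.
have -> : t `^ x = (2 * (x + 1)) `^ x * (t / (2 * (x + 1))) `^ x.
  by rewrite -powRM ?(ltW X0)// mulrC divfK// gt_eqF.
rewrite -mulrA ler_pM2l ?powR_gt0//.
have -> : expR (- t) = (expR (2^-1 * t))^-1 * expR (- (2^-1 * t)).
  by rewrite -expRN -expRD; congr expR; field.
by rewrite mulrA ler_piMl ?expR_ge0// ler_pdivrMr ?expR_gt0// mul1r.
Qed.

Lemma cvg_expRN_half : expR (- (2^-1 * t)) @[t --> +oo] --> (0 : R).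
Proof.
apply: (@cvg_comp _ _ _ (fun t => 2^-1 * t) (fun u => expR (- u)) _ +oo).
  by apply: gt0_cvgMry => //; rewrite invr_gt0.
exact: cvgr_expR.
Qed.

Lemma cvg_powR_at_right0 x : 0 <= x -> t `^ x @[t --> 0^'+] --> 0 `^ x.
Proof.
rewrite le_eqVlt => /predU1P[<-|x0].
  by rewrite powRr0; under eq_cvg do rewrite powRr0; exact: cvg_cst.
by rewrite powR0 ?gt_eqF//; exact: powR_cvg0.
Qed.

Lemma cvg_expRN_scaled k t : expR (- (k * u)) @[u --> t] --> expR (- (k * t)).
Proof.
apply: continuous_cvg; first exact: continuous_expR.
by apply: cvgN; apply: cvgMr; exact: cvg_id.
Qed.

Lemma is_derive_expRN k t :
  is_derive t 1 (fun u => expR (- (k * u))) (- k * expR (- (k * t))).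
Proof.
rewrite (_ : (fun u => _) = expR \o (fun u => - k * u)); last first.
  by apply/funext => u /=; rewrite mulNr.
have d1 : is_derive t 1 (fun u => - k * u) (- k).
  apply: (is_derive_eq (is_deriveZ (- k) (is_derive_id _ _))).
  by rewrite /GRing.scale/= mulr1.
apply: (is_derive_eq (is_derive1_comp (is_derive_expR _) d1)).
by rewrite mulNr mulrC.
Qed.

Lemma measurable_expRN k (A : set R) :
  measurable_fun A (fun t => expR (- (k * t))).
Proof.
apply: measurable_funTS; apply: continuous_measurable_fun => t.
exact: cvg_expRN_scaled.
Qed.

Let D : set (measurableTypeR R) := `]0, +oo[%classic.

Let mD : measurable D := measurable_itv _.

Lemma integral_expRN_half :
  (\int[mu]_(t in D) (expR (- (2^-1 * t)))%:E = (2%R)%:E)%E.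
Proof.
rewrite integral_itv_obnd_cbnd; last first.
  by apply/measurable_EFinP; exact: measurable_expRN.
rewrite (@ge0_continuous_FTC2y _ _ (fun t => - 2 * expR (- (2^-1 * t))) _ 0).
- rewrite mulr0 oppr0 expR0 mulr1 -EFinB sub0r. by rewrite opprK.
- by move=> t _; exact: expR_ge0.
- by apply: continuous_subspaceT => t; exact: cvg_expRN_scaled.
- by rewrite -(mulr0 (- 2)); apply: cvgMr; exact: cvg_expRN_half.
- move=> t _.
  by have [] := is_deriveZ (- 2) (is_derive_expRN 2^-1 t).
- by apply: cvgMr; apply: cvg_at_right_filter; exact: cvg_expRN_scaled.
- move=> t _; rewrite derive1E.
  have [_ ->] := is_deriveZ (- 2) (is_derive_expRN 2^-1 t).
  by rewrite /GRing.scale/= mulrA mulrNN divff// mul1r.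
Qed.

Lemma integrable_expRN_half :
  mu.-integrable D (EFin \o (fun t => expR (- (2^-1 * t)))).
Proof.
apply/integrableP; split.
  by apply/measurable_EFinP; exact: measurable_expRN.
under eq_integral do rewrite /= ger0_norm ?expR_ge0//.
by rewrite integral_expRN_half ltry.
Qed.

Lemma integrable_powR_expRN x : 0 <= x ->
  mu.-integrable D (EFin \o (fun t => t `^ x * expR (- t))).
Proof.
move=> x0; have [C C0 HC] := powR_expRN_le x0.
have intC : mu.-integrable D
    (fun t => C%:E * (EFin \o (fun t => expR (- (2^-1 * t)))) t)%E.
  exact: (integrableZl mD C integrable_expRN_half).
apply: (le_integrable mD _ _ intC).
- apply/measurable_EFinP; apply: measurable_funM.
    by apply: measurable_funTS; exact: measurable_powR.
  by apply: measurable_funTS; exact: measurableT_comp.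
- move=> t; rewrite /D/= in_itv/= andbT => t0.
  rewrite lee_fin !ger0_norm ?mulr_ge0 ?powR_ge0 ?expR_ge0 ?(ltW C0)//.
  by rewrite HC ?ltW.
Qed.

(** For x > 0, continuity at 0 is one-sided: [powR] is 1 on negative numbers. *)
Lemma continuous_powR_expRN x : 0 <= x ->
  {within `[0, +oo[, continuous (fun t => t `^ x * expR (- t))}.
Proof.
have cexp t : expR (- u) @[u --> t] --> expR (- t).
  by apply: continuous_cvg; [exact: continuous_expR|apply: cvgN; exact: cvg_id].
move=> x0; apply/continuous_within_itvcyP; split.
  move=> t; rewrite in_itv/= andbT => t0.
  apply: cvgM; last exact: cexp.
  have : {for t, continuous (fun u => u `^ x)}.
    apply: differentiable_continuous; apply/derivable1_diffP.
    by have [] := is_derive1_powR x t0.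
  exact.
by apply: cvgM; [exact: cvg_powR_at_right0|apply: cvg_at_right_filter; exact: cexp].
Qed.

(** Integration by parts on a half-line. The fundamental theorem is used for a
    nonnegative integrand, so the sign-changing derivative of t^x exp(-t) is
    shifted by E = C exp(-t/2), which dominates t^x exp(-t). *)
Lemma Gamma_rec x : 1 <= x -> Gamma (x + 1) = x * Gamma x.
Proof.
move=> x1; have x0 : 0 <= x by lra.
have xp : 0 <= x - 1 by lra.
have [C C0 HC] := powR_expRN_le x0.
pose E t := C * expR (- (2^-1 * t)).
pose G t := x * (t `^ (x - 1) * expR (- t)) - t `^ x * expR (- t).
pose P t := t `^ x * expR (- t) + - (2 * C) * expR (- (2^-1 * t)).
have P_lim : P t @[t --> +oo] --> 0.
  rewrite -[0]addr0 -[X in _ + X](mulr0 (- (2 * C))).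
  apply: cvgD; last by apply: cvgMr; exact: cvg_expRN_half.
  apply: (@squeeze_cvgr _ _ _ _ (cst 0) E).
  - near=> t; rewrite mulr_ge0 ?powR_ge0 ?expR_ge0//=.
    by apply: HC; near: t; exact: nbhs_pinfty_ge.
  - exact: cvg_cst.
  - by rewrite -(mulr0 C); apply: cvgMr; exact: cvg_expRN_half.
have P_deriv t : 0 < t -> is_derive t 1 P (E t + G t).
  move=> t0; have dp := is_derive1_powR x t0.
  have de : is_derive t 1 (fun u => expR (- u)) (- expR (- t)).
    have := is_derive_expRN 1 t; rewrite mul1r mulN1r.
    by under eq_fun do rewrite mul1r.
  have d2 := is_derive_expRN 2^-1 t.
  apply: (is_derive_eq (is_deriveD (is_deriveM dp de) (is_deriveZ (- (2 * C)) d2))).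
  by rewrite /E /G /GRing.scale/=; field.
have intE : mu.-integrable D (EFin \o E).
  have := integrableZl mD C integrable_expRN_half.
  exact.
have intG0 := integrable_powR_expRN xp.
have intG1 := integrable_powR_expRN x0.
have intxG0 : mu.-integrable D (EFin \o (fun t => x * (t `^ (x - 1) * expR (- t)))).
  have := integrableZl mD x intG0.
  exact.
have intG : mu.-integrable D (EFin \o G).
  exact: (integrableB mD intxG0 intG1).
have cE : {within `[0, +oo[, continuous (fun t => expR (- (2^-1 * t)))}.
  by apply: continuous_subspaceT => t; exact: cvg_expRN_scaled.
have : \int[mu]_(t in D) (E t + G t) = 2 * C.
  rewrite Rintegral_itv_obnd_cbnd; last exact: (integrableD mD intE intG).
  rewrite (@Rintegral_ge0_continuous_FTC2y _ _ P _ 0).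
  - by rewrite /P powR0 ?gt_eqF//; [rewrite mulr0 oppr0 expR0; ring|lra].
  - move=> t t0; rewrite /G.
    have : 0 <= x * (t `^ (x - 1) * expR (- t)).
      by rewrite !mulr_ge0 ?powR_ge0 ?expR_ge0.
    by have := HC t t0; rewrite -/(E t); lra.
  - move=> t; apply: continuousD.
      by apply: cvgMr; exact: cE.
    apply: continuousB.
      by apply: cvgMr; exact: continuous_powR_expRN.
    exact: continuous_powR_expRN.
  - exact: P_lim.
  - by move=> t t0; have [] := P_deriv t t0.
  - apply: cvgD; last first.
      by apply: cvgMr; apply: cvg_at_right_filter; exact: cvg_expRN_scaled.
    by have /continuous_within_itvcyP[] := continuous_powR_expRN x0.
  - move=> t; rewrite in_itv/= andbT => t0; rewrite derive1E.
    by have [_ ->] := P_deriv t t0.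
rewrite (RintegralD mD intE intG) (RintegralB mD intxG0 intG1).
rewrite (RintegralZl x mD intG0).
rewrite (RintegralZl C mD integrable_expRN_half) /Rintegral integral_expRN_half/=.
rewrite -!/(Rintegral _ _ _) => H.
rewrite /Gamma addrK -/D; move: H; rewrite /mu; lra.
Unshelve. all: by end_near.
Qed.

(** The integrand is at least exp(-2) on [1, 2]. *)
Lemma Gamma_gt0 x : 1 <= x -> 0 < Gamma x.
Proof.
move=> x1; have xp : 0 <= x - 1 by lra.
have sub : `[1, 2] `<=` D.
  move=> t; rewrite /D/= !in_itv/= => /andP[t1 _].
  by rewrite andbT; lra.
have m12 : measurable (`[1, 2]%classic : set (measurableTypeR R)).
  exact: measurable_itv.
have mu12 : mu (`[1, 2]%classic : set (measurableTypeR R)) = 1%E.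
  rewrite /mu (@lebesgue_measure_itv R `[1, 2])/= lte_fin ltr1n.
  by rewrite -EFinB; congr EFin; ring.
apply: (@lt_le_trans _ _ (\int[mu]_(t in `[1, 2]) expR (- 2))).
  rewrite Rintegral_cst// [X in fine X](_ : _ = 1%E); last exact: mu12.
  by rewrite mulr1 expR_gt0.
have intG := integrable_powR_expRN xp.
apply: (@le_trans _ _ (\int[mu]_(t in `[1, 2]) (t `^ (x - 1) * expR (- t)))).
  apply: le_Rintegral => //.
  - apply/integrableP; split; first exact: measurable_cst.
    rewrite integral_cst// [X in (_ * X)%E](_ : _ = 1%E); last exact: mu12.
    by rewrite mule1 ltry.
  - exact: integrableS intG.
  - move=> t /=; rewrite in_itv/= => /andP[t1 t2].
    rewrite -[leLHS]mul1r ler_pM ?expR_ge0//; last by rewrite ler_expR; lra.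
    by rewrite -[leLHS](powRr0 t) ler_powR.
rewrite /Gamma /Rintegral fine_le//.
- apply: integrable_fin_num => //; exact: integrableS intG.
- exact: integrable_fin_num.
- apply: ge0_subset_integral => //.
    by have /integrableP[] := intG.
  by move=> t _; rewrite lee_fin mulr_ge0 ?powR_ge0 ?expR_ge0.
Qed.
End Gamma_ge1.

Lemma natr_absz_floor (R : realType) (z : R) :
  1 <= z + `|Num.floor z|%N.+1%:R.
Proof.
rewrite -natr1 natr_absz addrA -lerBlDr subrr.
have /andP[zl _] := floor_itv z.
have := ler_norm (- Num.floor z); rewrite normrN -(ler_int R) mulrNz.
lra.
Qed.

(** The number of factors is arbitrary, by [Gamma_rec]; this is what makes the
    functional equation of 1 / Gamma valid at every real z. *)
Lemma rGammaE (R : realType) (z : R) (n : nat) : 1 <= z + n%:R ->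
  rGamma z = (\prod_(i < n) (z + i%:R)) / Gamma (z + n%:R).
Proof.
pose r n := (\prod_(i < n) (z + i%:R)) / Gamma (z + n%:R).
have rS k : 1 <= z + k%:R -> r k.+1 = r k.
  move=> zk; rewrite /r big_ord_recr/= -natr1 addrA Gamma_rec//.
  by field; rewrite gt_eqF ?Gamma_gt0//=; lra.
have rD k l : 1 <= z + k%:R -> r (k + l)%N = r k.
  move=> zk; elim: l => [|l <-]; first by rewrite addn0.
  by rewrite addnS rS// natrD addrA ler_wpDr.
have r_eq k l : 1 <= z + k%:R -> 1 <= z + l%:R -> r k = r l.
  move=> zk zl; have [kl|/ltnW lk] := leqP k l.
    by rewrite -(subnKC kl) rD.
  by rewrite -(subnKC lk) rD.
move=> zn; rewrite /rGamma -/(r _) -/(r n); apply: r_eq => //.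
exact: natr_absz_floor.
Qed.

Lemma rGamma_rec (R : realType) (z : R) : rGamma z = z * rGamma (z + 1).
Proof.
pose n := `|Num.floor z|%N.+1.
have zn : 1 <= z + n%:R by exact: natr_absz_floor.
rewrite (@rGammaE _ z n.+1) ?(@rGammaE _ (z + 1) n)//; last 2 first.
- lra.
- by rewrite -natr1; lra.
rewrite big_ord_recl/= addr0 mulrA -natr1 -addrA [1 + _]addrC; congr (_ * _ / _).
by apply: eq_bigr => i _; rewrite /bump leq0n natrD addrA.
Qed.

Lemma rGamma_ge1 (R : realType) (x : R) : 1 <= x -> rGamma x = (Gamma x)^-1.
Proof.
by move=> x1; rewrite (@rGammaE _ x 0) ?addr0// big_ord0 mul1r.
Qed.
(** * The Riesz difference operator *)

Section riesz.
Variable R : realType.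
Implicit Types beta : R.

Lemma gN beta (k : int) : g beta (- k) = g beta k.
Proof.
rewrite /g rmorphN/= opprK -exprz_inv invrN1.
by move: (Gamma _) (rGamma (_ - _ + _)) (rGamma _) => x y z; rewrite mulrAC.
Qed.

Lemma g_recE beta (k : nat) :
  (beta / 2 + k.+1%:R) * g beta k.+1 = (k%:R - beta / 2) * g beta k.
Proof.
rewrite /g -!pmulrn -!exprnP exprS.
have -> : beta / 2 - k.+1%:R + 1 = beta / 2 - k%:R by rewrite -natr1; ring.
have -> : beta / 2 + k%:R + 1 = beta / 2 + k.+1%:R by rewrite -natr1; ring.
rewrite (rGamma_rec (beta / 2 - k%:R)) (rGamma_rec (beta / 2 + k.+1%:R)).
move: (Gamma _) (rGamma (beta / 2 - k%:R + 1)) (rGamma _) => x y z; ring.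
Qed.

(** Minus the sum of the g_k over k > p, in product form: up to sign, the
    binomial coefficient of upper index beta - 1 that Pascal's rule yields. *)
Definition riesz_tail beta (p : nat) : R :=
  g beta 0 / 2 * \prod_(1 <= j < p.+1) ((j%:R - beta / 2) / (j%:R + beta / 2)).

Lemma riesz_tailS beta p : riesz_tail beta p.+1
  = riesz_tail beta p * ((p.+1%:R - beta / 2) / (p.+1%:R + beta / 2)).
Proof.
rewrite /riesz_tail; move: (g _ _) => G.
by rewrite big_nat_recr//=; exact: mulrA.
Qed.

Lemma g_tailE beta p : 0 < beta ->
  g beta p.+1 = riesz_tail beta p.+1 - riesz_tail beta p.
Proof.
move=> b0.
have den q : beta / 2 + q%:R != 0 :> R.
  by rewrite gt_eqF// ltr_wpDr//; lra.
elim: p => [|p IHp].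
  apply: (mulfI (den 1%N)); rewrite g_recE riesz_tailS /riesz_tail big_geq//.
  by set G := g _ (0 : int); move: G => G; field; lra.
apply: (mulfI (den p.+2)); rewrite g_recE IHp !riesz_tailS.
rewrite -[p.+2%:R]natr1; move: (riesz_tail _ _) => t.
have : 0 <= p.+1%:R :> R by [].
by move: (p.+1%:R) => q q0; field; lra.
Qed.

Lemma g0_gt0 beta : 0 <= beta -> 0 < g beta 0.
Proof.
move=> b0; rewrite /g expr0z mul1r mulr0z subr0 addr0 rGamma_ge1; last by lra.
rewrite mulr_gt0 ?mulr_gt0 ?invr_gt0// ?Gamma_gt0//; lra.
Qed.

Lemma g0E beta : 0 <= beta ->
  g beta 0 = Gamma (beta + 1) / Gamma (beta / 2 + 1) ^+ 2.
Proof.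
move=> b0; rewrite /g expr0z mul1r mulr0z subr0 addr0 rGamma_ge1; last by lra.
by field; rewrite gt_eqF// Gamma_gt0//; lra.
Qed.

Lemma riesz_tail_gt0 beta p : 0 < beta -> beta < 2 -> 0 < riesz_tail beta p.
Proof.
move=> b0 b2; rewrite /riesz_tail mulr_gt0//.
  by rewrite divr_gt0// g0_gt0// ltW.
rewrite big_seq; apply: prodr_gt0 => j; rewrite mem_index_iota => /andP[j1 _].
have {j1} : 1 <= j%:R :> R by rewrite ler1n.
by move=> j1; rewrite divr_gt0//; lra.
Qed.

Lemma riesz_tail_nincr beta p q : 0 < beta -> beta < 2 -> (p <= q)%N ->
  riesz_tail beta q <= riesz_tail beta p.
Proof.
move=> b0 b2; elim: q => [|q IHq]; first by rewrite leqn0 => /eqP ->.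
rewrite leq_eqVlt => /predU1P[->//|]; rewrite ltnS => /IHq; apply: le_trans.
rewrite riesz_tailS ler_piMr ?(ltW (riesz_tail_gt0 _ _ _))//.
have q0 : 0 <= q.+1%:R :> R by [].
by rewrite ler_pdivrMr; lra.
Qed.

Lemma g_le0 beta (k : int) : 0 < beta -> beta < 2 -> k != 0 -> g beta k <= 0.
Proof.
move=> b0 b2; case: (intP k) => [|p _|p _]; first by rewrite eqxx.
  by rewrite g_tailE// subr_le0 riesz_tail_nincr.
by rewrite gN g_tailE// subr_le0 riesz_tail_nincr.
Qed.

(** The two products are what the row misses to the left of 1 and to the right
    of M - 1, the sum of all the g_k being 0. *)
Lemma riesz_row_sum beta (M i : nat) : 0 < beta -> (0 < i < M)%N ->
  \sum_(1 <= j < M) g beta (i%:Z - j%:Z)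
  = riesz_tail beta i.-1 + riesz_tail beta (M - i.+1).
Proof.
move=> b0 /andP[i0 iM].
have tele p : \sum_(1 <= l < p.+1) g beta l%:Z
    = riesz_tail beta p - riesz_tail beta 0.
  rewrite big_add1/= -(telescope_sumr (riesz_tail beta)) //; apply: eq_bigr => l _.
  exact: g_tailE.
rewrite (@big_cat_nat _ _ _ i)//=; last exact: ltnW.
rewrite big_nat_rev/= [X in _ + X]big_ltn// subrr.
rewrite (eq_big_nat _ _ (F2 := fun j => g beta j%:Z)); last first.
  by move=> j /andP[j0 ji]; congr (g _ _); lia.
rewrite -{1}(prednK i0) tele.
rewrite -[i.+1]add1n big_addn (eq_bigr (fun j => g beta j%:Z)); last first.
  by move=> j _; rewrite -gN; congr (g _ _); lia.
have -> : (M - i = (M - (1 + i)).+1)%N by lia.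
rewrite tele.
have -> : riesz_tail beta 0 = g beta 0 / 2 by rewrite /riesz_tail big_geq// mulr1.
by rewrite add1n; lra.
Qed.

(** The product decays no faster than p^(-beta). One step of the induction
    needs (p / (p + 1))^beta <= (p + 1 - b) / (p + 1 + b) with b = beta / 2;
    Bernoulli gives (p / (p + 1))^b <= (p + 1 - b) / (p + 1), and the rest is
    (p + 1 - b) (p + 1 + b) <= (p + 1)^2. *)
Lemma riesz_tail_powR beta p : 0 < beta -> beta < 2 -> (2 <= p)%N ->
  riesz_tail beta 2 * 2 `^ beta <= riesz_tail beta p * p%:R `^ beta.
Proof.
move=> b0 b2; elim: p => // p IHp; rewrite leq_eqVlt => /predU1P[<-//|].
rewrite ltnS => p2; apply: le_trans (IHp p2) _.
rewrite riesz_tailS -mulrA ler_pM2l ?riesz_tail_gt0//.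
have P2 : 2 <= p%:R :> R by rewrite ler_nat.
have p0 : 0 < p%:R :> R by lra.
have p10 : 0 < p.+1%:R :> R by [].
have sq (x : R) : x `^ beta = (x `^ (beta / 2)) ^+ 2.
  by rewrite -powR_mulrn ?powR_ge0// -powRrM divfK.
have b01 : 0 <= beta / 2 <= 1 by lra.
have := powR_le_tangent b01 p0 p10; rewrite !sq.
have : 0 <= p%:R `^ (beta / 2) by exact: powR_ge0.
have : 0 < p.+1%:R `^ (beta / 2) by exact: powR_gt0.
move: (p%:R `^ _) (p.+1%:R `^ _) => x y y0 x0 xy.
have {xy} : x ^+ 2 <= (y * (1 + beta / 2 * (p%:R / p.+1%:R - 1))) ^+ 2.
  by rewrite ler_sqr ?nnegrE// (le_trans x0).
move=> /le_trans; apply; rewrite exprMn mulrC ler_pM2r ?exprn_gt0//.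
rewrite -[p.+1%:R]natr1; set t := p%:R in P2 *.
have -> : 1 + beta / 2 * (t / (t + 1) - 1) = (t + 1 - beta / 2) / (t + 1).
  by field; lra.
rewrite expr_div_n ler_pdivrMr ?exprn_gt0//; last lra.
rewrite mulrAC ler_pdivlMr; last lra.
rewrite -subr_ge0.
have -> : (t + 1 - beta / 2) * (t + 1) ^+ 2
  - (t + 1 - beta / 2) ^+ 2 * (t + 1 + beta / 2)
  = (t + 1 - beta / 2) * (beta / 2) ^+ 2 by ring.
by rewrite mulr_ge0 ?sqr_ge0//; lra.
Qed.

(** The rational factor of cstar is the product over j = 1, 2 that defines
    [riesz_tail beta 2]; the factor 6 + beta cancels one power of
    3 + beta / 2. *)
Lemma cstarE beta : 0 < beta -> cstar beta
  = 2 * expR (- 2) * riesz_tail beta 2 * (3 + beta / 2) `^ beta.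
Proof.
move=> b0; rewrite /cstar /r_ powRS; last by lra.
rewrite -mulrA -(g0E (ltW b0)) /riesz_tail big_nat_recr//= big_nat1.
by field; rewrite !gt_eqF//; lra.
Qed.

Lemma cstar_gt0 beta : 0 < beta -> beta < 2 -> 0 < cstar beta.
Proof.
move=> b0 b2; rewrite cstarE//.
apply: mulr_gt0; last by apply: powR_gt0; lra.
apply: mulr_gt0; last exact: riesz_tail_gt0.
by rewrite mulr_gt0 ?expR_gt0.
Qed.

Lemma riesz_tail_lb beta M : 1 < beta -> beta < 2 -> (2 <= M)%N ->
  cstar beta <= 2 * riesz_tail beta M * (2 * M%:R) `^ beta.
Proof.
move=> b1 b2 M2; have b0 : 0 < beta by lra.
rewrite cstarE// powRM//.
have -> : 2 * expR (- 2) * riesz_tail beta 2 * (3 + beta / 2) `^ beta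
  = 2 * riesz_tail beta 2 * (expR (- 2) * (3 + beta / 2) `^ beta) by ring.
(* As beta < 2, the base 3 + beta / 2 is less than 4. *)
have H : expR (- 2) * (3 + beta / 2) `^ beta <= 2 `^ beta * 2 `^ beta.
  apply: (@le_trans _ _ (1 * (2 * 2) `^ beta)); last by rewrite mul1r powRM.
  rewrite ler_pM ?expR_ge0 ?powR_ge0// ?expR_le1.
  by rewrite ge0_ler_powR ?nnegrE//; lra.
have tp := riesz_tail_gt0 2 b0 b2.
have : 2 * riesz_tail beta 2 * (expR (- 2) * (3 + beta / 2) `^ beta)
    <= 2 * riesz_tail beta 2 * (2 `^ beta * 2 `^ beta).
  by rewrite ler_wpM2l//; lra.
move/le_trans; apply.
have := riesz_tail_powR b0 b2 M2; rewrite -(ler_pM2l (powR_gt0 beta (ltr0Sn R 1))).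
lra.
Qed.

Lemma riesz_coercive beta (M : nat) (v : nat -> R) :
  1 < beta -> beta < 2 -> (2 <= M)%N ->
  cstar beta / (2 * M%:R) `^ beta * (\sum_(1 <= i < M) v i ^+ 2)
  <= \sum_(1 <= i < M) v i * \sum_(1 <= j < M) g beta (i%:Z - j%:Z) * v j.
Proof.
move=> b1 b2 M2; have b0 : 0 < beta by lra.
apply: quadratic_form_lb => [i j|i j ij|i].
- by rewrite -gN; congr (g _ _); lia.
- by rewrite g_le0//; apply: contraNN ij; rewrite subr_eq0 eqz_nat.
rewrite mem_index_iota => iM; rewrite riesz_row_sum//.
have M0 : 0 < 2 * M%:R :> R by rewrite mulr_gt0// ltr0n; lia.
rewrite ler_pdivrMr ?powR_gt0//.
apply: le_trans (riesz_tail_lb b1 b2 M2) _.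
rewrite ler_wpM2r ?powR_ge0//.
have := @riesz_tail_nincr beta i.-1 M b0 b2.
have := @riesz_tail_nincr beta (M - i.+1) M b0 b2.
move=> /(_ ltac:(lia)) H1 /(_ ltac:(lia)) H2; lra.
Qed.
End riesz.
(** * Coefficients of the distributed-order operator *)

Section chat.
Variables (R : realType) (omega : R -> R) (J : nat) (T tau s : R).

Lemma alpha01 r : (0 < J)%N -> (r <= 2 * J)%N -> 0 <= alpha R J r <= 1.
Proof.
move=> J0 rJ; have J2 : 0 < (2 * J)%:R :> R by rewrite ltr0n muln_gt0.
rewrite /alpha /dalpha divr_ge0//= ler_pdivrMr// mul1r ler_nat.
exact: rJ.
Qed.

Lemma rGamma_1subE (al : R) : al <= 1 ->
  rGamma (1 - al) = (1 - al) / Gamma (2 - al).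
Proof.
move=> al1; rewrite rGamma_rec.
have -> : 1 - al + 1 = 2 - al by ring.
by rewrite rGamma_ge1//; lra.
Qed.

Lemma Gamma_3subE (al : R) : al <= 1 -> Gamma (3 - al) = (2 - al) * Gamma (2 - al).
Proof.
move=> al1; have -> : 3 - al = 2 - al + 1 by ring.
by rewrite Gamma_rec//; lra.
Qed.

(** The factor of c_k at the r-th order in chat_k. *)
Definition quad_weight r : R :=
  lambda omega J r * (tau `^ (- alpha R J r) / Gamma (2 - alpha R J r)).

(** The sum in the denominator of the stability bound. *)
Definition fractional_rate : R := \sum_(0 <= r < (2 * J).+1)
  lambda omega J r / T `^ alpha R J r * rGamma (1 - alpha R J r).

Hypotheses (J0 : (0 < J)%N) (omega_gt0 : forall al, 0 <= al <= 1 -> 0 < omega al)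
  (T0 : 0 < T) (tau0 : 0 < tau).

Let al01 r : (0 <= r < (2 * J).+1)%N -> 0 <= alpha R J r <= 1.
Proof. by move=> /andP[_ rJ]; exact: alpha01. Qed.

Lemma lambda_gt0 r : (0 <= r < (2 * J).+1)%N -> 0 < lambda omega J r.
Proof.
move=> rJ; rewrite /lambda mulr_gt0//.
  rewrite mulr_gt0 ?omega_gt0 ?al01// /trapezoid_weight.
  by case: ifP; rewrite ?invr_gt0.
by rewrite /dalpha invr_gt0 ltr0n muln_gt0.
Qed.

Lemma Gamma_2sub_gt0 r : (0 <= r < (2 * J).+1)%N -> 0 < Gamma (2 - alpha R J r).
Proof. by move=> /al01 al; apply: Gamma_gt0; lra. Qed.

Lemma quad_weight_gt0 r : (0 <= r < (2 * J).+1)%N -> 0 < quad_weight r.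
Proof.
move=> rJ; apply: mulr_gt0; first exact: lambda_gt0.
by apply: divr_gt0; [exact: powR_gt0|exact: Gamma_2sub_gt0].
Qed.

Lemma F_termE r : (0 <= r < (2 * J).+1)%N ->
  let al := alpha R J r in
  lambda omega J r / Gamma (3 - al) * s `^ (1 - al) * (s - (1 - al / 2))
    * tau `^ (2 - al)
  = tau ^+ 2 / 2 * (quad_weight r
      * (2 / (2 - al) * s `^ (1 - al) * (s - (1 - al / 2)))).
Proof.
move=> rJ al; have := al01 rJ; have := Gamma_2sub_gt0 rJ; rewrite -/al.
rewrite /quad_weight -/al => G0 /andP[_ al1]; rewrite Gamma_3subE//.
have -> : tau `^ (2 - al) = tau ^+ 2 * tau `^ (- al).
  by rewrite powRD ?powR_mulrn ?(ltW tau0)// (gt_eqF tau0) implybT.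
move: (Gamma _) G0 => G G0; field; rewrite gt_eqF//=; lra.
Qed.

Lemma F_eq0_sum : F omega J tau s = 0 ->
  \sum_(0 <= r < (2 * J).+1) quad_weight r
    * (2 / (2 - alpha R J r) * s `^ (1 - alpha R J r)
       * (s - (1 - alpha R J r / 2))) = 0.
Proof.
have t2 : tau ^+ 2 / 2 != 0 by rewrite gt_eqF// divr_gt0// exprn_gt0.
move=> F0; apply: (mulfI t2); rewrite mulr0 -[RHS]F0 mulr_sumr.
by apply: eq_big_nat => r rJ; exact: esym (F_termE rJ).
Qed.

(** All the terms of F are negative for s < 1/2 and positive for s > 1. *)
Lemma F_root_bounds : 0 < s -> F omega J tau s = 0 -> 2^-1 <= s <= 1.
Proof.
move=> s0 /F_eq0_sum H.
have pos r : (0 <= r < (2 * J).+1)%N ->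
    0 < quad_weight r * (2 / (2 - alpha R J r) * s `^ (1 - alpha R J r)).
  move=> rJ; apply: mulr_gt0; first exact: quad_weight_gt0.
  have /andP[_ al1] := al01 rJ.
  by rewrite mulr_gt0 ?powR_gt0// divr_gt0//; lra.
apply/andP; split; rewrite leNgt; apply/negP => s1.
  have : \sum_(0 <= r < (2 * J).+1) quad_weight r
    * (2 / (2 - alpha R J r) * s `^ (1 - alpha R J r)
       * (s - (1 - alpha R J r / 2))) < \sum_(0 <= r < (2 * J).+1) 0.
    apply: ltr_sum_nat => // r rJ; rewrite mulrA pmulr_rlt0 ?pos//.
    by have := al01 rJ; lra.
  by rewrite H big1// ltxx.
have : \sum_(0 <= r < (2 * J).+1) 0 < \sum_(0 <= r < (2 * J).+1) quad_weight r
    * (2 / (2 - alpha R J r) * s `^ (1 - alpha R J r)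
       * (s - (1 - alpha R J r / 2))).
  apply: ltr_sum_nat => // r rJ; rewrite mulrA pmulr_rgt0 ?pos//.
  by have := al01 rJ; lra.
by rewrite H big1// ltxx.
Qed.

Lemma chat_nincr_pos n k : 0 < s -> (0 < k)%N -> (k.+1 < n)%N ->
  chat omega J tau s n k.+1 <= chat omega J tau s n k.
Proof.
move=> s0 k0 kn; apply: ler_sum_nat => r rJ.
by rewrite (ler_pM2l (quad_weight_gt0 rJ)) c_nincr// al01.
Qed.

Lemma chat0_ge0 n : 0 < s -> 0 <= chat omega J tau s n 0.
Proof.
move=> s0; rewrite /chat big_seq; apply: sumr_ge0 => r.
rewrite mem_index_iota => rJ.
by apply: mulr_ge0; [exact: ltW (quad_weight_gt0 rJ)|rewrite c0_ge0// al01].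
Qed.

(** The lower bounds of [two_step_inequality], weighted by [quad_weight],
    add up to a multiple of F(s), which vanishes. *)
Lemma chat_two_step n : 0 < s -> F omega J tau s = 0 -> (1 < n)%N ->
  s ^+ 2 * chat omega J tau s n 1 <= (2 * s - 1) * chat omega J tau s n 0.
Proof.
move=> s0 F0 n1; have s01 := F_root_bounds s0 F0.
rewrite -subr_ge0 -(F_eq0_sum F0) /chat !mulr_sumr -sumrB.
apply: ler_sum_nat => r rJ /=; have alr := al01 rJ.
rewrite -/(quad_weight r) !(mulrCA _ (quad_weight r)) -mulrBr.
rewrite (ler_pM2l (quad_weight_gt0 rJ)).
apply: le_trans (two_step_inequality s01 alr) _.
have c0E : c s (alpha R J r) n 0 = a s (alpha R J r) 0 + b s (alpha R J r) 1.
  by rewrite /c gtn_eqF.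
(* Equality for n > 2; for n = 2 the term b_2 >= 0 is absent from c_1. *)
have c1_le : c s (alpha R J r) n 1
    <= a s (alpha R J r) 1 + b s (alpha R J r) 2 - b s (alpha R J r) 1.
  rewrite /c (gtn_eqF n1)/=; case: ifP => _//.
  by have := b_ge0 s0 alr (isT : (0 < 2)%N); lra.
rewrite c0E lerB// ler_wpM2l// sqr_ge0.
exact.
Qed.

(** From index 0 to 1, the decrease follows from [chat_two_step] and
    2 s - 1 <= s^2. *)
Lemma chat_nincr n k : 0 < s -> F omega J tau s = 0 -> (k.+1 < n)%N ->
  chat omega J tau s n k.+1 <= chat omega J tau s n k.
Proof.
move=> s0 F0; case: k => [|k] kn; last exact: chat_nincr_pos.
have s01 := F_root_bounds s0 F0; have key := chat_two_step s0 F0 kn.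
have c0 := chat0_ge0 n s0.
rewrite -(ler_pM2l (exprn_gt0 2 s0)); apply: le_trans key _.
rewrite ler_wpM2r//; have := sqr_ge0 (s - 1); lra.
Qed.

Lemma chat_last_lb n : 2^-1 <= s <= 1 -> (0 < n)%N -> n%:R * tau <= T ->
  fractional_rate / 2 <= chat omega J tau s n n.-1.
Proof.
move=> /andP[s2 s1] n0 nT; rewrite /fractional_rate mulr_suml.
have n1 : 1 <= n%:R :> R by rewrite ler1n.
apply: ler_sum_nat => r rJ /=; have alr := al01 rJ.
have /andP[al0 al1] := alr.
rewrite rGamma_1subE// -/(quad_weight r).
have H := c_last_lb s2 alr n0.
apply: le_trans (ler_wpM2l (ltW (quad_weight_gt0 rJ)) H).
rewrite /quad_weight; set al := alpha R J r in alr al0 al1 *.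
have G0 := Gamma_2sub_gt0 rJ; rewrite -/al in G0.
have lam := lambda_gt0 rJ.
rewrite -powRN.
have -> : lambda omega J r * T `^ (- al) * ((1 - al) / Gamma (2 - al)) / 2
  = lambda omega J r * ((1 - al) / 2) / Gamma (2 - al) * T `^ (- al).
  by move: (Gamma _) G0 => G G0; field; rewrite gt_eqF.
have -> : lambda omega J r * (tau `^ (- al) / Gamma (2 - al)) *
    ((1 - al) / 2 * (n%:R - 1 + s) `^ (- al))
  = lambda omega J r * ((1 - al) / 2) / Gamma (2 - al)
    * (tau `^ (- al) * (n%:R - 1 + s) `^ (- al)).
  by move: (Gamma _) G0 => G G0; field; rewrite gt_eqF.
apply: ler_wpM2l.
  by apply: divr_ge0 (ltW G0); apply: mulr_ge0; [exact: ltW|lra].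
rewrite -powRM ?(ltW tau0)//; last by lra.
rewrite !powRN lef_pV2 ?posrE ?powR_gt0// ?mulr_gt0//; last by lra.
apply: ge0_ler_powR => //; rewrite ?nnegrE ?(ltW T0)//.
  by rewrite mulr_ge0 ?(ltW tau0)//; lra.
apply: le_trans nT; rewrite mulrC ler_pM2r//; lra.
Qed.

Lemma fractional_rate_gt0 : 0 < fractional_rate.
Proof.
rewrite /fractional_rate big_nat_recl//=; apply: ltr_wpDr.
  rewrite big_seq; apply: sumr_ge0 => r; rewrite mem_index_iota => rJ.
  have rJ' : (0 <= r.+1 < (2 * J).+1)%N by rewrite ltnS.
  have alr := al01 rJ'; have G0 := Gamma_2sub_gt0 rJ'.
  rewrite rGamma_1subE; last by case/andP: alr.
  apply: mulr_ge0; apply: divr_ge0; rewrite ?powR_ge0 ?(ltW G0)//; last by lra.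
  exact: ltW (lambda_gt0 rJ').
have rJ : (0 <= 0 < (2 * J).+1)%N by [].
have G0 := Gamma_2sub_gt0 rJ.
have al0 : alpha R J 0 = 0 by rewrite /alpha mul0r.
rewrite rGamma_1subE ?al0//; rewrite al0 in G0.
apply: mulr_gt0.
  by apply: divr_gt0; [exact: lambda_gt0 rJ|exact: powR_gt0].
by apply: divr_gt0 G0; lra.
Qed.
End chat.
(** * Energy balance of one time level *)

(** Testing with v = s u^n + (1 - s) u^(n-1): [energy_le] at each node, then
    2 v f <= 2 kappa v^2 + f^2 / (2 kappa), where the coercivity absorbs the
    first term. *)
Lemma level_energy (R : realType) (w fv : nat -> R) (u B : nat -> nat -> R)
    (s kappa h : R) (M n : nat) :
  (0 < n)%N -> 2^-1 <= s -> 0 <= w 0%N -> 0 <= w n.-1 ->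
  (forall k, (0 < k)%N -> (k.+1 < n)%N -> w k.+1 <= w k) ->
  ((1 < n)%N -> s ^+ 2 * w 1%N <= (2 * s - 1) * w 0%N) ->
  0 < kappa -> 0 <= h ->
  (forall v : nat -> R, kappa * (\sum_(1 <= i < M) v i ^+ 2)
    <= \sum_(1 <= i < M) v i * \sum_(1 <= j < M) B i j * v j) ->
  (forall i, (1 <= i < M)%N ->
    \sum_(0 <= k < n) w k * (u (n - k)%N i - u (n - k - 1)%N i)
    = - (\sum_(1 <= j < M) B i j * (s * u n j + (1 - s) * u (n - 1)%N j))
      + fv i) ->
  \sum_(0 <= k < n) w k
      * (normsq h M (u (n - k)%N) - normsq h M (u (n - k - 1)%N))
    <= normsq h M fv / (2 * kappa).
Proof.
move=> n0 s2 w0 wn w_nincr w01 kappa0 h0 coercive scheme.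
pose v i := s * u n i + (1 - s) * u (n - 1)%N i.
have -> : \sum_(0 <= k < n) w k
      * (normsq h M (u (n - k)%N) - normsq h M (u (n - k - 1)%N))
    = h * \sum_(1 <= i < M) \sum_(0 <= k < n)
        w k * (u (n - k)%N i ^+ 2 - u (n - k - 1)%N i ^+ 2).
  rewrite exchange_big/= mulr_sumr; apply: eq_bigr => k _.
  by rewrite /normsq -mulrBr -sumrB mulrCA mulr_sumr.
rewrite /normsq -mulrA; apply: ler_wpM2l => //.
apply: (@le_trans _ _ (\sum_(1 <= i < M) 2 * v i
    * (- (\sum_(1 <= j < M) B i j * v j) + fv i))).
  apply: ler_sum_nat => i iM.
  have := energy_le (fun n => u n i) n0 s2 w0 wn w_nincr w01.
  by rewrite scheme.
apply: (@le_trans _ _ (\sum_(1 <= i < M) 2 * (kappa * v i ^+ 2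
    - v i * \sum_(1 <= j < M) B i j * v j)
    + (\sum_(1 <= i < M) fv i ^+ 2) / (2 * kappa))).
  rewrite mulr_suml -big_split/=; apply: ler_sum => i _.
  have : 0 <= (2 * kappa * v i - fv i) ^+ 2 / (2 * kappa).
    by rewrite divr_ge0 ?sqr_ge0//; lra.
  have -> : (2 * kappa * v i - fv i) ^+ 2 / (2 * kappa)
    = 2 * kappa * v i ^+ 2 - 2 * v i * fv i + fv i ^+ 2 / (2 * kappa).
    by field; rewrite gt_eqF.
  lra.
rewrite -mulr_sumr sumrB -mulr_sumr gerDr.
have := coercive v; lra.
Qed.

Lemma sum_interior (V : nmodType) (M : nat) (G : nat -> V) : (0 < M)%N ->
  G 0%N = 0 -> G M = 0 ->
  \sum_(0 <= j < M.+1) G j = \sum_(1 <= j < M) G j.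
Proof.
by move=> M0 G0 GM; rewrite big_ltn// big_nat_recr//= G0 GM add0r addr0.
Qed.

(* [u n i] is u_i^n. In the space sum the index is j = i - k, so that
   k = i - M, ..., i corresponds to j = M, ..., 0. The maximum is over
   nonnegative numbers, so its unit is 0. For beta = 2, where cstar vanishes,
   the right-hand side is +oo whatever f is. *)
Theorem theorem2p2 (R : realType) (L T K beta : R) (M N J : nat)
    (omega : R -> R) (sigma : R) (f : R -> R -> R) (phi : R -> R)
    (u : nat -> nat -> R)
    (L_gt0 : 0 < L) (T_gt0 : 0 < T) (K_gt0 : 0 < K)
    (beta_gt1 : 1 < beta) (beta_le2 : beta <= 2)
    (M_ge2 : (2 <= M)%N) (N_ge1 : (1 <= N)%N) (J_ge1 : (1 <= J)%N)
    (omega_ge0 : forall al : R, 0 <= al <= 1 -> 0 <= omega al)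
    (omega_neq0 : forall al : R, 0 <= al <= 1 -> omega al != 0)
    (omega_integrable :
      (@lebesgue_measure R).-integrable `[0, 1] (EFin \o omega))
    (omega_int_gt0 : 0 < \int[@lebesgue_measure R]_(al in `[0, 1]) omega al) :
  let h := L / M%:R in
  let tau := T / N%:R in
  let x i := i%:R * h in
  let fs n i := f (x i) ((n%:R - 1 + sigma) * tau) in
  forall (sigma_gt0 : 0 < sigma) (sigma_root : F omega J tau sigma = 0)
    (scheme : forall i n, (1 <= i <= M - 1)%N -> (1 <= n <= N)%N ->
      \sum_(0 <= k < n)
        chat omega J tau sigma n k * (u (n - k)%N i - u (n - k - 1)%N i)
      = - K * h `^ (- beta)
          * (\sum_(0 <= j < M.+1) g beta (i%:Z - j%:Z)
               * (sigma * u n j + (1 - sigma) * u (n - 1)%N j))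
        + fs n i)
    (boundary : forall n, (n <= N)%N -> u n 0%N = 0 /\ u n M = 0)
    (initial : forall i, (1 <= i <= M - 1)%N -> u 0%N i = phi (x i)),
  forall n, (1 <= n <= N)%N ->
  let bound : \bar R :=
    if beta == 2 then +oo%E else
    (normsq h M (u 0%N)
      + (2 * L) `^ beta
          / (K * cstar beta
               * \sum_(0 <= r < (2 * J).+1)
                   lambda omega J r / T `^ alpha R J r
                     * rGamma (1 - alpha R J r))
        * \big[Num.max/0]_(1 <= l < n.+1) normsq h M (fs l))%:E in
  ((normsq h M (u n))%:E <= bound)%E.
Proof.
move=> h tau x fs sigma_gt0 sigma_root scheme boundary initial n0 /andP[n0_gt0 n0N].
rewrite /=; case: eqVneq => [_|beta_neq2]; first exact: leey.
have beta_lt2 : beta < 2 by rewrite lt_neqAle beta_neq2.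
have omega_gt0 al : 0 <= al <= 1 -> 0 < omega al.
  by move=> al01; rewrite lt_neqAle eq_sym omega_neq0// omega_ge0.
have M_gt0n : (0 < M)%N by exact: ltnW.
have M_gt0 : 0 < M%:R :> R by rewrite ltr0n.
have N_gt0 : 0 < N%:R :> R by rewrite ltr0n.
have h_gt0 : 0 < h by rewrite divr_gt0.
have tau_gt0 : 0 < tau by rewrite divr_gt0.
have s01 := F_root_bounds J_ge1 omega_gt0 tau_gt0 sigma_gt0 sigma_root.
have rate_gt0 := fractional_rate_gt0 J_ge1 omega_gt0 T_gt0.
have L2_gt0 : 0 < (2 * L) `^ beta by rewrite powR_gt0 ?mulr_gt0.
have cst_gt0 : 0 < cstar beta by apply: cstar_gt0; lra.
(* The coercivity constant K h^(-beta) cstar / (2M)^beta, as h M = L. *)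
have [kappa kappaE kappa_gt0] : exists2 kappa,
    kappa = K * cstar beta / (2 * L) `^ beta & 0 < kappa.
  by eexists; [reflexivity|rewrite divr_gt0// mulr_gt0].
rewrite lee_fin -/(fractional_rate omega J T).
set S := fractional_rate omega J T in rate_gt0 *.
set X := \big[Num.max/0]_(1 <= l < n0.+1) normsq h M (fs l).
have X_ge0 : 0 <= X by exact: bigmax_ge_id.
have -> : (2 * L) `^ beta / (K * cstar beta * S) * X = X / (kappa * S).
  by rewrite kappaE; field; rewrite !gt_eqF.
have node_le n : (n <= n0)%N -> n%:R * tau <= T.
  move=> nn0; rewrite /tau mulrCA ler_piMr ?(ltW T_gt0)//.
  by rewrite ler_pdivrMr// mul1r ler_nat (leq_trans nn0).
(* The factor 1/2 of Young's inequality cancels the factor 1/2 of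
   [chat_last_lb]. *)
apply: (@memory_gronwall _ (chat omega J tau sigma)
  (fun n => normsq h M (u n)) n0 (S / 2)).
- by rewrite divr_gt0.
- by rewrite divr_ge0// mulr_ge0 ?ltW.
- by move=> n k /andP[kn _]; apply: chat_nincr.
- by move=> n /andP[n_gt0 nn0]; apply: chat_last_lb => //; exact: node_le.
2: exact: leqnn.
move=> n /andP[n_gt0 nn0].
have -> : S / 2 * (X / (kappa * S)) = X / (2 * kappa).
  by field; rewrite !gt_eqF.
apply: (@le_trans _ _ (normsq h M (fs n) / (2 * kappa))); last first.
  rewrite ler_wpM2r ?invr_ge0 ?mulr_ge0 ?(ltW kappa_gt0)//.
  apply: (@le_bigmax_seq _ _ _ _ 0 n xpredT (fun l => normsq h M (fs l))) => //.
  by rewrite mem_index_iota n_gt0.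
have last_ge0 : 0 <= chat omega J tau sigma n n.-1.
  apply: le_trans (chat_last_lb J_ge1 omega_gt0 T_gt0 tau_gt0 s01 n_gt0
    (node_le n nn0)).
  by rewrite divr_ge0// ltW.
have /andP[s2 _] := s01.
apply: (@level_energy _ _ _ _
  (fun i j => K * h `^ (- beta) * g beta (i%:Z - j%:Z)) sigma).
- exact: n_gt0.
- exact: s2.
- exact: chat0_ge0.
- exact: last_ge0.
- by move=> k k_gt0 kn; apply: chat_nincr.
- by move=> n1; apply: chat_two_step.
- exact: kappa_gt0.
- exact: ltW.
- move=> v.
  have /(ler_wpM2l (ltW (mulr_gt0 K_gt0 (powR_gt0 (- beta) h_gt0)))) :=
    riesz_coercive v beta_gt1 beta_lt2 M_ge2.
  have -> : K * h `^ (- beta) * (cstar beta / (2 * M%:R) `^ beta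
      * (\sum_(1 <= i < M) v i ^+ 2)) = kappa * (\sum_(1 <= i < M) v i ^+ 2).
    rewrite kappaE powRN.
    have -> : 2 * L = h * (2 * M%:R) by rewrite /h; field; rewrite gt_eqF.
    rewrite (@powRM _ h) ?(ltW h_gt0) ?mulr_ge0 ?(ltW M_gt0)//.
    have hb := powR_gt0 beta h_gt0.
    have Mb : 0 < (2 * M%:R) `^ beta by rewrite powR_gt0// mulr_gt0.
    by move: (cstar beta) => z; field; rewrite !gt_eqF.
  move/le_trans; apply; rewrite mulr_sumr; apply: ler_sum => i _.
  rewrite mulrCA !mulr_sumr; apply: ler_sum => j _.
  by rewrite -!mulrA.
move=> i iM; rewrite scheme; last 2 first.
- by have /andP[i0 i1] := iM; rewrite i0/= subn1 -ltnS prednK.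
- by rewrite n_gt0 (leq_trans nn0).
congr (_ + _).
have nN : (n <= N)%N by exact: leq_trans n0N.
have [un0 unM] := boundary n nN.
have [up0 upM] := boundary (n - 1)%N (leq_trans (leq_subr 1 n) nN).
rewrite sum_interior//; last 2 first.
- by rewrite un0 up0 !mulr0 (addr0 (0 : R)) mulr0.
- by rewrite unM upM !mulr0 (addr0 (0 : R)) mulr0.
rewrite mulNr mulNr mulr_sumr.
congr (- _); apply: eq_bigr => j _; exact: mulrA.
Qed.
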